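(* Let $(X,r_X)$, $(Y,r_Y)$ be disjoint solutions of the Yang-Baxter equation, with associated monoids $S=S(X,r_X)$ and $T=S(Y,r_Y)$. Let ${}^Y\bullet,\bullet^X$ be a regular pair of ground actions, $(Z,r)$ the corresponding regular extension and $U=S(Z,r)$ its associated monoid. Then $(Z,r)$ obeys the Yang-Baxter equation if and only if the following conditions hold: (1) $U=S\bowtie T$, where $(S,T)$ is a strong matched pair with actions extending the ground actions; and (2) $(S,U)$ and $(U,T)$ are matched pairs with canonical actions induced from the actions of $S,T$. In this case $G_Z=G_X\bowtie G_Y$, where $G_X=G(X,r_X)$, $G_Y=G(Y,r_Y)$, $G_Z=G(Z,r)$ are the associated groups.
   Context: A solution $(X,r_X)$ is a nonempty set $X$ with a bijective map $r_X:X\times X\to X\times X$, $r_X(x,y)=({}^xy,x^y)$, satisfying the Yang-Baxter equation $r^{12}r^{23}r^{12}=r^{23}r^{12}r^{23}$ on $X^3$; similarly $r_Y(\alpha,\beta)=({}^\alpha\beta,\alpha^\beta)$. For a set with bijection $(X,r)$, the associated monoid $S(X,r)$ (resp. group $G(X,r)$) is the monoid (resp. group) generated by $X$ with defining relations $xy=zt$ whenever $r(x,y)=(z,t)$; the monoid is graded by length. A pair of maps (ground actions) $Y\times X\to X$, $(\alpha,x)\mapsto{}^\alpha x$ and $Y\times X\to Y$, $(\alpha,x)\mapsto\alpha^x$ is regular if $\rho(\alpha,x)=({}^\alpha x,\alpha^x)$ is a bijection $Y\times X\to X\times Y$. The corresponding regular extension is $Z=X\sqcup Y$ with $r|_{X\times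 X}=r_X$, $r|_{Y\times Y}=r_Y$, $r|_{Y\times X}=\rho$, $r|_{X\times Y}=\rho^{-1}$. Matched pair of monoids $(S,T)$: a left action $(a,u)\mapsto{}^au\in S$ of $T$ on $S$ and a right action $(a,u)\mapsto a^u\in T$ of $S$ on $T$ such that for all $a,b\in T$, $u,v\in S$: ${}^a1=1$, ${}^1u=u$, $1^u=1$, $a^1=a$; ${}^{ab}u={}^a({}^bu)$, $a^{uv}=(a^u)^v$; ${}^a(uv)=({}^au)({}^{a^u}v)$, $(ab)^u=(a^{{}^bu})(b^u)$. It is strong if $(a,u)\mapsto({}^au,a^u)$ is a bijection $T\times S\to S\times T$. The double cross product $S\bowtie T$ is $S\times T$ with product $(u,a)(v,b)=(u\,{}^av,a^v\,b)$; write $u.a=(u,a)$. ''$U=S\bowtie T$'' means that the map $S\bowtie T\to U$, $u.a\mapsto ua$, induced by $X,Y\subset Z$, is an isomorphism. The same notion of $\bowtie$ is used for groups, with actions of $G_X,G_Y$ induced from those of $Z$. By a general theorem, for a solution $(X,r_X)$ the actions of $X$ on itself given by $r_X$ extend uniquely to left and right actions of $S(X,r_X)$ on itself making $(S,S)$ a graded matched pair with ${}^uv\,u^v=uv$; likewise for $T$. The canonical actions in (2) are those extending these and the $(S,T)$ actions: for $(S,U)$, $U$ acts on the left of $S$ by ${}^{u.a}v={}^u({}^av)$ and $S$ acts on the right of $U$ by $(u.a)^v=u^{{}^av}.a^v$; for $(U,T)$, $T$ acts on the left of $U$ by ${}^b(u.a)={}^bu.{}^{b^u}a$ and $U$ acts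 on the right of $T$ by $b^{u.a}=(b^u)^a$.
   Formalization: For the last sentence (G_Z = G_X ⋈ G_Y) only, it is additionally assumed that each ground action map x ↦ ^αx on X and α ↦ α^x on Y is a bijection; without this the sentence fails, e.g. for r_X = r_Y = id on two-element sets with ^{a_i}x_j = x_i, a_i^{x_j} = a_j. *)

(* Defs.v *)
From HB Require Import structures.
From mathcomp Require Import all_boot.
From mathcomp Require Import generic_quotient boolp.

Set Implicit Arguments.
Unset Strict Implicit.
Unset Printing Implicit Defensive.

Local Open Scope quotient_scope.
Local Open Scope group_scope.

Definition r12 (X : Type) (r : X * X -> X * X) (p : X * X * X) : X * X * X :=
  (r p.1, p.2).

Definition r23 (X : Type) (r : X * X -> X * X) (p : X * X * X) : X * X * X :=
  let q := r (p.1.2, p.2) in (p.1.1, q.1, q.2).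

Definition ybe (X : Type) (r : X * X -> X * X) : Prop :=
  r12 r \o r23 r \o r12 r =1 r23 r \o r12 r \o r23 r.

Record solution (X : Type) (r : X * X -> X * X) : Prop := Solution {
  sol_inhabited : inhabited X;
  sol_bij : bijective r;
  sol_ybe : ybe r
}.

Definition word (A : Type) := seq A.
HB.instance Definition _ (A : Type) := gen_eqMixin (word A).
HB.instance Definition _ (A : Type) := gen_choiceMixin (word A).

Section Presentation.
Variables (A : Type) (R : word A -> word A -> Prop).

Inductive congruence : word A -> word A -> Prop :=
| cong_step p u v q : R u v -> congruence (p ++ u ++ q) (p ++ v ++ q)
| cong_refl u : congruence u u
| cong_sym u v : congruence u v -> congruence v u
| cong_trans v u w : congruence u v -> congruence v w -> congruence u w.

Definition congb (u v : word A) : bool := `[< congruence u v >].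

Lemma congb_refl : reflexive congb.
Proof. by move=> u; apply/asboolP; exact: cong_refl. Qed.

Lemma congb_sym : symmetric congb.
Proof. by move=> u v; apply/asboolP/asboolP; exact: cong_sym. Qed.

Lemma congb_trans : transitive congb.
Proof.
by move=> v u w /asboolP uv /asboolP vw; apply/asboolP; exact: cong_trans uv vw.
Qed.

Canonical congb_equiv := EquivRel congb congb_refl congb_sym congb_trans.

Definition presented := {eq_quot congb_equiv}.
HB.instance Definition _ := Choice.on presented.
HB.instance Definition _ := Quotient.on presented.

Definition class_of (w : word A) : presented := \pi w.

Lemma class_ofP u v : class_of u = class_of v <-> congruence u v.
Proof. by split=> [/eqmodP/asboolP | H] //; apply/eqmodP/asboolP. Qed.

Lemma class_of_repr (u : presented) : class_of (repr u) = u.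
Proof. exact: reprK. Qed.

Lemma cong_repr w : congruence (repr (class_of w)) w.
Proof. by apply/class_ofP; rewrite class_of_repr. Qed.

Lemma cong_cat u u' v v' :
  congruence u u' -> congruence v v' -> congruence (u ++ v) (u' ++ v').
Proof.
have catl s : forall a b, congruence a b -> congruence (s ++ a) (s ++ b).
  move=> a b; elim=> {a b} [p a b q Rab|a|a b _|b a c _ + _].
  - by rewrite !(catA s); exact: cong_step.
  - exact: cong_refl.
  - exact: cong_sym.
  - exact: cong_trans.
have catr s : forall a b, congruence a b -> congruence (a ++ s) (b ++ s).
  move=> a b; elim=> {a b} [p a b q Rab|a|a b _|b a c _ + _].
  - by rewrite -!catA; exact: cong_step.
  - exact: cong_refl.
  - exact: cong_sym.
  - exact: cong_trans.
by move=> uu' vv'; apply: cong_trans (catr v _ _ uu') (catl u' _ _ vv').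
Qed.

Definition pres_one : presented := class_of [::].
Definition pres_mul (u v : presented) : presented := class_of (repr u ++ repr v).

Lemma pres_mulE u v : pres_mul (class_of u) (class_of v) = class_of (u ++ v).
Proof. by apply/class_ofP/cong_cat; exact: cong_repr. Qed.

Lemma pres_mulA : associative pres_mul.
Proof.
move=> u v w; rewrite -[u]class_of_repr -[v]class_of_repr -[w]class_of_repr.
by rewrite !pres_mulE catA.
Qed.

Lemma pres_mul1 : left_id pres_one pres_mul.
Proof. by move=> u; rewrite -[u]class_of_repr pres_mulE. Qed.

Lemma pres_mulr1 : right_id pres_one pres_mul.
Proof. by move=> u; rewrite -[u]class_of_repr pres_mulE cats0. Qed.

HB.instance Definition _ :=
  isMonoid.Build presented pres_mulA pres_mul1 pres_mulr1.

Lemma class_ofM u v : class_of u * class_of v = class_of (u ++ v).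
Proof. exact: pres_mulE. Qed.

Lemma class_of1 : class_of [::] = 1.
Proof. by []. Qed.

End Presentation.

Section InducedMap.
Variables (A B : Type) (RA : word A -> word A -> Prop).
Variables (RB : word B -> word B -> Prop) (f : A -> B).

(* This is independent of the choice of representative as soon as f maps
   defining relations to consequences of the defining relations (pres_mapE). *)
Definition pres_map (u : presented RA) : presented RB :=
  class_of RB (map f (repr u)).

Hypothesis fR : forall u v, RA u v -> congruence RB (map f u) (map f v).

Lemma cong_map u v : congruence RA u v -> congruence RB (map f u) (map f v).
Proof.
elim=> {u v} [p u v q uv|u|u v _|v u w _ + _].
- rewrite !map_cat; apply: cong_cat; first exact: cong_refl.
  by apply: cong_cat; [exact: fR|exact: cong_refl].
- exact: cong_refl.
- exact: cong_sym.
- exact: cong_trans.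
Qed.

Lemma pres_mapE w : pres_map (class_of RA w) = class_of RB (map f w).
Proof. by apply/class_ofP/cong_map/cong_repr. Qed.

Lemma pres_map_morphism : monoid_morphism pres_map.
Proof.
split; first by rewrite -class_of1 pres_mapE.
move=> u v; rewrite -[u]class_of_repr -[v]class_of_repr.
by rewrite class_ofM !pres_mapE map_cat class_ofM.
Qed.

End InducedMap.

Inductive monoid_rel (X : Type) (r : X * X -> X * X) : word X -> word X -> Prop :=
| MonoidRel x y z t : r (x, y) = (z, t) ->
    monoid_rel r [:: x; y] [:: z; t].

Definition assoc_monoid (X : Type) (r : X * X -> X * X) : monoidType :=
  presented (monoid_rel r).

Definition mgen (X : Type) (r : X * X -> X * X) (x : X) : assoc_monoid r :=
  class_of (monoid_rel r) [:: x].

(* The length grading; the defining relations are homogeneous (degreeE). *)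
Definition degree (X : Type) (r : X * X -> X * X) (u : assoc_monoid r) : nat :=
  size (repr (u : presented (monoid_rel r))).

Lemma degreeE (X : Type) (r : X * X -> X * X) (w : word X) :
  degree (class_of (monoid_rel r) w : assoc_monoid r) = size w.
Proof.
rewrite /degree; have := cong_repr (monoid_rel r) w.
move: (repr _) => w'; elim=> {w w'} [p u v q uv|u|u v _|v u w _ + _].
- by case: uv => x y z t _; rewrite !size_cat.
- by [].
- by move=> ->.
- by move=> -> ->.
Qed.

(* The group G(X, r) is presented as a monoid on the letters (x, true), which
   stands for x, and (x, false), which stands for x^-1. *)
Inductive group_rel (X : Type) (r : X * X -> X * X) :
  word (X * bool) -> word (X * bool) -> Prop :=
| GroupCancel x b : group_rel r [:: (x, b); (x, ~~ b)] [::]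
| GroupRel x y z t : r (x, y) = (z, t) ->
    group_rel r [:: (x, true); (y, true)] [:: (z, true); (t, true)].

Section AssociatedGroup.
Variables (X : Type) (r : X * X -> X * X).

Definition assoc_group_sort := presented (group_rel r).
HB.instance Definition _ := Monoid.on assoc_group_sort.

Definition inv_letter (l : X * bool) : X * bool := (l.1, ~~ l.2).
Definition inv_word (w : word (X * bool)) : word (X * bool) :=
  rev (map inv_letter w).

Definition group_inv (u : assoc_group_sort) : assoc_group_sort :=
  class_of (group_rel r) (inv_word (repr u)).

Lemma cong_mulwV w : congruence (group_rel r) (w ++ inv_word w) [::].
Proof.
elim: w => [|[x b] w IHw]; first exact: cong_refl.
have -> : ((x, b) :: w) ++ inv_word ((x, b) :: w) =
    [:: (x, b)] ++ (w ++ inv_word w) ++ [:: (x, ~~ b)].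
  by rewrite /inv_word /= rev_cons -cats1 -catA.
apply: (@cong_trans _ _ ([:: (x, b)] ++ [::] ++ [:: (x, ~~ b)])).
  apply: cong_cat; first exact: cong_refl.
  by apply: cong_cat; [exact: IHw|exact: cong_refl].
exact: (cong_step [::] [::] (GroupCancel r x b)).
Qed.

Lemma inv_wordK : involutive inv_word.
Proof.
move=> w; rewrite /inv_word map_rev revK -map_comp -[RHS]map_id.
by apply: eq_map => -[x b]; rewrite /inv_letter /= negbK.
Qed.

Lemma group_mulVg : left_inverse 1 group_inv *%g.
Proof.
move=> u; rewrite -{2}[u]class_of_repr [LHS]class_ofM; apply/class_ofP.
by rewrite -{2}[repr u]inv_wordK; exact: cong_mulwV.
Qed.

Lemma group_mulgV : right_inverse 1 group_inv *%g.
Proof.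
move=> u; rewrite -{1}[u]class_of_repr [LHS]class_ofM; apply/class_ofP.
exact: cong_mulwV.
Qed.

HB.instance Definition _ := hasInv.Build assoc_group_sort group_inv.
HB.instance Definition _ :=
  Monoid_isGroup.Build assoc_group_sort group_mulVg group_mulgV.

Definition assoc_group : groupType := assoc_group_sort.

Definition ggen (x : X) : assoc_group := class_of (group_rel r) [:: (x, true)].

End AssociatedGroup.

Arguments mgen {X} r x.
Arguments ggen {X} r x.

(* lact a u is the left action of a : T on u : S and ract a u is the right
   action of u : S on a : T. *)
Record matched_pair (S T : monoidType)
    (lact : T -> S -> S) (ract : T -> S -> T) : Prop := MatchedPair {
  mp_lact1 : forall a, lact a 1 = 1;
  mp_1lact : forall u, lact 1 u = u;
  mp_1ract : forall u, ract 1 u = 1;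
  mp_ract1 : forall a, ract a 1 = a;
  mp_lactA : forall a b u, lact (a * b) u = lact a (lact b u);
  mp_ractA : forall a u v, ract a (u * v) = ract (ract a u) v;
  mp_lactM : forall a u v, lact a (u * v) = lact a u * lact (ract a u) v;
  mp_ractM : forall a b u, ract (a * b) u = ract a (lact b u) * ract b u
}.

Definition strong (S T : Type) (lact : T -> S -> S) (ract : T -> S -> T) : Prop :=
  bijective (fun p : T * S => (lact p.1 p.2, ract p.1 p.2)).

Definition double_cross (S T : monoidType) (lact : T -> S -> S)
  (ract : T -> S -> T) (mp : matched_pair lact ract) : Type := (S * T)%type.

Section DoubleCross.
Variables (S T : monoidType) (lact : T -> S -> S) (ract : T -> S -> T).
Variable mp : matched_pair lact ract.

HB.instance Definition _ := Choice.copy (double_cross mp) (S * T)%type.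

Definition dc_one : double_cross mp := (1, 1).
Definition dc_mul (p q : double_cross mp) : double_cross mp :=
  (p.1 * lact p.2 q.1, ract p.2 q.1 * q.2).

Lemma dc_mulA : associative dc_mul.
Proof.
case=> [u a] [v b] [w c]; rewrite /dc_mul /=; congr (_, _).
  by rewrite (mp_lactM mp) -(mp_lactA mp) !mulgA.
by rewrite (mp_ractM mp) (mp_ractA mp) !mulgA.
Qed.

Lemma dc_mul1 : left_id dc_one dc_mul.
Proof. by case=> u a; rewrite /dc_mul /= (mp_1lact mp) (mp_1ract mp) !mul1g. Qed.

Lemma dc_mulr1 : right_id dc_one dc_mul.
Proof. by case=> u a; rewrite /dc_mul /= (mp_lact1 mp) (mp_ract1 mp) !mulg1. Qed.

HB.instance Definition _ :=
  isMonoid.Build (double_cross mp) dc_mulA dc_mul1 dc_mulr1.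

Lemma dc_mulE (u v : S) (a b : T) :
  ((u, a) : double_cross mp) * ((v, b) : double_cross mp) =
  (u * lact a v, ract a v * b) :> double_cross mp.
Proof. by []. Qed.

End DoubleCross.

Definition is_double_cross (S T U : monoidType) (iS : S -> U) (iT : T -> U)
    (lact : T -> S -> S) (ract : T -> S -> T) (mp : matched_pair lact ract) : Prop :=
  let m := fun p : double_cross mp => iS p.1 * iT p.2 in
  monoid_morphism m /\ bijective m.

Definition ground_map (X Y : Type) (lact : Y -> X -> X) (ract : Y -> X -> Y)
  (p : Y * X) : X * Y := (lact p.1 p.2, ract p.1 p.2).

Definition regular (X Y : Type) (lact : Y -> X -> X) (ract : Y -> X -> Y) : Prop :=
  bijective (ground_map lact ract).

Lemma regular_inverse (X Y : Type) (lact : Y -> X -> X) (ract : Y -> X -> Y) :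
  regular lact ract ->
  exists g, cancel (ground_map lact ract) g /\ cancel g (ground_map lact ract).
Proof. by case=> g fK gK; exists g. Qed.

Definition ground_inv (X Y : Type) (lact : Y -> X -> X) (ract : Y -> X -> Y)
  (hreg : regular lact ract) : X * Y -> Y * X :=
  projT1 (cid (regular_inverse hreg)).

Section RegularExtension.
Variables (X Y : Type) (rX : X * X -> X * X) (rY : Y * Y -> Y * Y).
Variables (lact : Y -> X -> X) (ract : Y -> X -> Y) (hreg : regular lact ract).

Lemma ground_mapK : cancel (ground_map lact ract) (ground_inv hreg).
Proof. exact: (projT2 (cid (regular_inverse hreg))).1. Qed.

Lemma ground_invK : cancel (ground_inv hreg) (ground_map lact ract).
Proof. exact: (projT2 (cid (regular_inverse hreg))).2. Qed.

Definition regular_extension (p : (X + Y) * (X + Y)) : (X + Y) * (X + Y) :=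
  match p with
  | (inl x, inl y) => let q := rX (x, y) in (inl q.1, inl q.2)
  | (inr a, inr b) => let q := rY (a, b) in (inr q.1, inr q.2)
  | (inr a, inl x) => (inl (lact a x), inr (ract a x))
  | (inl x, inr a) => let q := ground_inv hreg (x, a) in (inr q.1, inl q.2)
  end.

Definition monoid_inl : assoc_monoid rX -> assoc_monoid regular_extension :=
  @pres_map X (X + Y) (monoid_rel rX) (monoid_rel regular_extension) inl.

Definition monoid_inr : assoc_monoid rY -> assoc_monoid regular_extension :=
  @pres_map Y (X + Y) (monoid_rel rY) (monoid_rel regular_extension) inr.

Definition group_inl : assoc_group rX -> assoc_group regular_extension :=
  @pres_map (X * bool) ((X + Y) * bool) (group_rel rX)
    (group_rel regular_extension) (fun l => (inl l.1, l.2)).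

Definition group_inr : assoc_group rY -> assoc_group regular_extension :=
  @pres_map (Y * bool) ((X + Y) * bool) (group_rel rY)
    (group_rel regular_extension) (fun l => (inr l.1, l.2)).

Lemma monoid_inl_morphism : monoid_morphism monoid_inl.
Proof.
apply: pres_map_morphism => _ _ [x y z t E].
apply: (@cong_step _ _ [::] [:: inl x; inl y] [:: inl z; inl t] [::]).
by constructor; rewrite /= E.
Qed.

Lemma monoid_inr_morphism : monoid_morphism monoid_inr.
Proof.
apply: pres_map_morphism => _ _ [x y z t E].
apply: (@cong_step _ _ [::] [:: inr x; inr y] [:: inr z; inr t] [::]).
by constructor; rewrite /= E.
Qed.

Lemma group_inl_morphism : monoid_morphism group_inl.
Proof.
apply: pres_map_morphism => _ _ [x b|x y z t E].
  exact: (cong_step [::] [::] (GroupCancel _ (inl x) b)).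
apply: (@cong_step _ _ [::] [:: (inl x, true); (inl y, true)]
          [:: (inl z, true); (inl t, true)] [::]).
by apply: GroupRel; rewrite /= E.
Qed.

Lemma group_inr_morphism : monoid_morphism group_inr.
Proof.
apply: pres_map_morphism => _ _ [x b|x y z t E].
  exact: (cong_step [::] [::] (GroupCancel _ (inr x) b)).
apply: (@cong_step _ _ [::] [:: (inr x, true); (inr y, true)]
          [:: (inr z, true); (inr t, true)] [::]).
by apply: GroupRel; rewrite /= E.
Qed.

End RegularExtension.

Arguments regular_extension {X Y} rX rY {lact ract} hreg p.
Arguments monoid_inl {X Y} rX rY {lact ract} hreg u.
Arguments monoid_inr {X Y} rX rY {lact ract} hreg u.
Arguments group_inl {X Y} rX rY {lact ract} hreg u.
Arguments group_inr {X Y} rX rY {lact ract} hreg u.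

(* An action of a group is by bijections, so this is what it takes for the
   ground actions to induce actions of G(X, rX) and G(Y, rY); a regular pair of
   ground actions need not satisfy it. *)
Definition nondegenerate_ground (X Y : Type)
    (lact : Y -> X -> X) (ract : Y -> X -> Y) : Prop :=
  (forall a, bijective (lact a)) /\ (forall x, bijective (fun a => ract a x)).

Definition extends_ground (X Y S T : Type) (gX : X -> S) (gY : Y -> T)
    (lact : Y -> X -> X) (ract : Y -> X -> Y)
    (la : T -> S -> S) (ra : T -> S -> T) : Prop :=
  forall a x, la (gY a) (gX x) = gX (lact a x) /\ ra (gY a) (gX x) = gY (ract a x).

(* The actions of S(X, r) on itself extending those of X on X given by r; for a
   solution r there is exactly one such pair. *)
Record self_actions (X : Type) (r : X * X -> X * X)
    (la ra : assoc_monoid r -> assoc_monoid r -> assoc_monoid r) : Prop :=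
  SelfActions {
    sa_extends : extends_ground (mgen r) (mgen r)
                   (fun x y => (r (x, y)).1) (fun x y => (r (x, y)).2) la ra;
    sa_matched : matched_pair la ra;
    sa_graded : forall u v, degree (la u v) = degree v /\ degree (ra u v) = degree u;
    sa_braided : forall u v, la u v * ra u v = u * v
  }.

Arguments self_actions {X} r la ra.

Section CanonicalActions.
Variables (S T U : monoidType) (iS : S -> U) (iT : T -> U).
Variables (la : T -> S -> S) (ra : T -> S -> T).

(* The element of U written u.a; every element of U has a unique such
   expression when U is the double cross product of S and T, so that the
   equations below then define the actions completely. *)
Definition dot (u : S) (a : T) : U := iS u * iT a.

Definition canonical_SU (lS rS : S -> S -> S)
    (lSU : U -> S -> S) (rSU : U -> S -> U) : Prop :=
  forall u a v, lSU (dot u a) v = lS u (la a v) /\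
                rSU (dot u a) v = dot (rS u (la a v)) (ra a v).

Definition canonical_UT (lT rT : T -> T -> T)
    (lUT : T -> U -> U) (rUT : T -> U -> T) : Prop :=
  forall b u a, lUT b (dot u a) = dot (la b u) (lT (ra b u) a) /\
                rUT b (dot u a) = rT (ra b u) a.

End CanonicalActions.

(* Main.v *)
(** A map rho : B * A -> A * B extends uniquely to a matched pair of actions of the
free monoids on A and B upon each other; it passes to presented monoids as soon as
one letter moved past a relation gives a relation and is itself moved to the same
letter. For Yang-Baxter maps this is a mixed braid relation on B x A x A and on
B x B x A, and every matched pair of the theorem arises by restricting the extended
map r: to Y x X, X x X, Y x Y, Z x X and Y x Z. Since r is rho or its inverse
on mixed pairs, the Yang-Baxter equation for r reduces to the mixed relations on
Y x X x X and Y x Y x X. Conversely these relations, which hold for letters and not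
only for their products, are recovered by acting with a product of two generators
in U, written in its two orders, on a third: generators are detected by length, and
the two components by the uniqueness of u.a.
For the groups, rho is first extended to signed letters by reading the square
a x = (lact a x) (ract a x) from its four corners. *)

Require Import Defs.
From HB Require Import structures.
From mathcomp Require Import all_boot.
From mathcomp Require Import boolp.

Set Implicit Arguments.
Unset Strict Implicit.
Unset Printing Implicit Defensive.

Local Open Scope group_scope.

(** * Actions of two free monoids on each other *)

Section WordActions.
Variables (A B : Type) (rho : B * A -> A * B).

(** The letter [b] crosses [w] from left to right. In [pushw] the last letter of [s], being adjacent
    to [w], crosses first. *)
Fixpoint push (b : B) (w : seq A) : seq A * B :=
  if w is a :: w' then
    let p := rho (b, a) in let q := push p.2 w' in (p.1 :: q.1, q.2)
  else ([::], b).

Fixpoint pushw (s : seq B) (w : seq A) : seq A * seq B :=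
  if s is b :: s' then
    let p := pushw s' w in let q := push b p.1 in (q.1, q.2 :: p.2)
  else (w, [::]).

(* In the paper's notation, wl s w is the left action of s on w and wr s w the
   right action of w on s. *)
Definition wl s w := (pushw s w).1.
Definition wr s w := (pushw s w).2.

Lemma push_cat b u v : push b (u ++ v) =
  ((push b u).1 ++ (push (push b u).2 v).1, (push (push b u).2 v).2).
Proof. by elim: u b => [|a u IHu] b /=; [case: push|rewrite IHu]. Qed.

Lemma wl_nil s : wl s [::] = [::].
Proof. by rewrite /wl; elim: s => //= b s ->. Qed.

Lemma wr_nil s : wr s [::] = s.
Proof.
by rewrite /wr; elim: s => //= b s ->; rewrite -/(wl s [::]) wl_nil.
Qed.

Lemma wl_cat1 s t w : wl (s ++ t) w = wl s (wl t w).
Proof. by rewrite /wl; elim: s => //= b s ->. Qed.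

Lemma wr_cat1 s t w : wr (s ++ t) w = wr s (wl t w) ++ wr t w.
Proof.
by rewrite /wr; elim: s => //= b s ->; rewrite -!/(wl _ _) wl_cat1.
Qed.

Lemma pushw_cat2 s u v : pushw s (u ++ v) =
  (wl s u ++ wl (wr s u) v, wr (wr s u) v).
Proof.
rewrite /wl /wr; elim: s => //= b s ->.
by rewrite push_cat /=.
Qed.

Lemma wl_cat2 s u v : wl s (u ++ v) = wl s u ++ wl (wr s u) v.
Proof. by rewrite {1}/wl pushw_cat2. Qed.

Lemma wr_cat2 s u v : wr s (u ++ v) = wr (wr s u) v.
Proof. by rewrite {1}/wr pushw_cat2. Qed.

Lemma size_wl s w : size (wl s w) = size w.
Proof.
rewrite /wl; elim: s => //= b s <-.
by move: (pushw s w).1 => u; elim: u b => //= a u IHu b; rewrite IHu.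
Qed.

Lemma size_wr s w : size (wr s w) = size s.
Proof. by rewrite /wr; elim: s => //= b s ->. Qed.

Lemma wl12 b x y :
  wl [:: b] [:: x; y] = [:: (rho (b, x)).1; (rho ((rho (b, x)).2, y)).1].
Proof. by []. Qed.

Lemma wr12 b x y : wr [:: b] [:: x; y] = [:: (rho ((rho (b, x)).2, y)).2].
Proof. by []. Qed.

Lemma wl21 b c x : wl [:: b; c] [:: x] = [:: (rho (b, (rho (c, x)).1)).1].
Proof. by []. Qed.

Lemma wr21 b c x :
  wr [:: b; c] [:: x] = [:: (rho (b, (rho (c, x)).1)).2; (rho (c, x)).2].
Proof. by []. Qed.

(** A hypothesis about one letter in front of a relation thus still applies after that letter has
    crossed any prefix. *)
Lemma wr_letter b w : exists b', wr [:: b] w = [:: b'].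
Proof. by rewrite /wr /=; eexists. Qed.

Lemma wl_letter s a : exists a', wl s [:: a] = [:: a'].
Proof.
by case: (wl s [:: a]) (size_wl s [:: a]) => [|a' []] // _; exists a'.
Qed.

End WordActions.

Section WordActionsMap.
Variables (A B A' B' : Type) (rho : B * A -> A * B) (rho' : B' * A' -> A' * B').
Variables (f : A -> A') (g : B -> B').
Hypothesis fg : forall b a, rho' (g b, f a) = (f (rho (b, a)).1, g (rho (b, a)).2).

Lemma pushw_map s w :
  pushw rho' (map g s) (map f w) = (map f (wl rho s w), map g (wr rho s w)).
Proof.
rewrite /wl /wr; elim: s => //= b s ->; move: (pushw rho s w).1 => /= u.
have -> : push rho' (g b) (map f u) =
          (map f (push rho b u).1, g (push rho b u).2).
  by elim: u b => //= a u IHu b; rewrite fg IHu.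
by [].
Qed.

Lemma wl_map s w : wl rho' (map g s) (map f w) = map f (wl rho s w).
Proof. by rewrite {1}/wl pushw_map. Qed.

Lemma wr_map s w : wr rho' (map g s) (map f w) = map g (wr rho s w).
Proof. by rewrite {1}/wr pushw_map. Qed.

End WordActionsMap.

Section WordActionsInverse.
Variables (A B : Type) (rho : B * A -> A * B) (sig : A * B -> B * A).
Hypothesis rhoK : cancel rho sig.

(** The crossings are undone in reverse order: [sig] starts at the last letter of the image, where
    the moved letter came out. *)
Lemma push_inv b w :
  pushw sig (push rho b w).1 [:: (push rho b w).2] = ([:: b], w).
Proof.
elim: w b => //= a w IHw b; rewrite IHw /=.
by rewrite -surjective_pairing rhoK.
Qed.

Lemma pushw_inv s w : pushw sig (wl rho s w) (wr rho s w) = (s, w).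
Proof.
rewrite /wl /wr; elim: s => [|b s IHs] /=.
  have := wl_nil sig w; have := wr_nil sig w.
  by rewrite /wl /wr; case: pushw => ? ? /= -> ->.
rewrite -cat1s pushw_cat2 /wl /wr push_inv /=.
by rewrite IHs.
Qed.

Lemma wl_inv s w : wl sig (wl rho s w) (wr rho s w) = s.
Proof. by rewrite {1}/wl pushw_inv. Qed.

Lemma wr_inv s w : wr sig (wl rho s w) (wr rho s w) = w.
Proof. by rewrite {1}/wr pushw_inv. Qed.

End WordActionsInverse.

(** * Descent of the word actions to presented monoids *)

Section PresentedActions.
Variables (A B : Type) (rho : B * A -> A * B).
Variables (RA : word A -> word A -> Prop) (RB : word B -> word B -> Prop).

Local Notation wl := (wl rho).
Local Notation wr := (wr rho).

(* Asking for equality, rather than congruence, of the letters on the other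
   side is what makes both conditions stable under further pushing. *)
Definition compatl : Prop := forall b u v, RA u v ->
  congruence RA (wl [:: b] u) (wl [:: b] v) /\ wr [:: b] u = wr [:: b] v.

Definition compatr : Prop := forall a s t, RB s t ->
  congruence RB (wr s [:: a]) (wr t [:: a]) /\ wl s [:: a] = wl t [:: a].

Definition pact_l (b : presented RB) (u : presented RA) : presented RA :=
  class_of RA (wl (repr b) (repr u)).
Definition pact_r (b : presented RB) (u : presented RA) : presented RB :=
  class_of RB (wr (repr b) (repr u)).

Hypotheses (cl : compatl) (cr : compatr).

(** For a single letter this is an induction on the congruence: the letter leaves both sides of a
    relation unchanged in identity, so the suffix [q] is transformed in the same way on both sides.
    The letters of [s] then cross one after the other, the last one first. *)
Lemma cong_wl2 s u v : congruence RA u v ->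
  congruence RA (wl s u) (wl s v) /\ wr s u = wr s v.
Proof.
have letter b : forall x y, congruence RA x y ->
    congruence RA (wl [:: b] x) (wl [:: b] y) /\ wr [:: b] x = wr [:: b] y.
  move=> x y; elim=> {x y} [p x y q xy|x|x y _ [IH1 IH2]|y x z _ [H1 H2] _ [H3 H4]].
  - rewrite !wl_cat2 !wr_cat2; have [b' ->] := wr_letter rho b p.
    have [H1 H2] := cl b' xy; rewrite H2; split=> //.
    by apply: cong_cat (cong_refl _ _) _; apply: cong_cat H1 (cong_refl _ _).
  - by split=> //; exact: cong_refl.
  - by split=> //; exact: cong_sym.
  - by split; [exact: cong_trans H1 H3|rewrite H2].
move=> uv; elim: s => [|b s [IH1 IH2]]; first by split.
rewrite -cat1s !wl_cat1 !wr_cat1 IH2; have [H1 H2] := letter b _ _ IH1.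
by rewrite H2.
Qed.

(** The mirror image. The induction on [w] generalises [s] and [t], which change whenever a letter
    of [w] has crossed them. *)
Lemma cong_wr1 s t w : congruence RB s t ->
  congruence RB (wr s w) (wr t w) /\ wl s w = wl t w.
Proof.
have letter a : forall x y, congruence RB x y ->
    congruence RB (wr x [:: a]) (wr y [:: a]) /\ wl x [:: a] = wl y [:: a].
  move=> x y; elim=> {x y} [p x y q xy|x|x y _ [IH1 IH2]|y x z _ [H1 H2] _ [H3 H4]].
  - rewrite !wr_cat1 !wl_cat1; have [a' ->] := wl_letter rho q a.
    have [H1 H2] := cr a' xy; rewrite H2; split=> //.
    by apply: cong_cat (cong_refl _ _) _; apply: cong_cat H1 (cong_refl _ _).
  - by split=> //; exact: cong_refl.
  - by split=> //; exact: cong_sym.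
  - by split; [exact: cong_trans H1 H3|rewrite H2].
elim: w s t => [|a w IHw] s t st; first by rewrite !wr_nil !wl_nil.
have [H1 H2] := letter a _ _ st; have [H3 H4] := IHw _ _ H1.
by rewrite -cat1s !wl_cat2 !wr_cat2 H2 H4.
Qed.

(** Another representative of [s] yields the very same word, by [cong_wr1]; another one of [w]
    yields a congruent word, by [cong_wl2]. *)
Lemma pact_lE s w : pact_l (class_of RB s) (class_of RA w) = class_of RA (wl s w).
Proof.
apply/class_ofP; have [_ ->] := cong_wr1 (repr (class_of RA w)) (cong_repr RB s).
exact: (cong_wl2 _ (cong_repr RA w)).1.
Qed.

Lemma pact_rE s w : pact_r (class_of RB s) (class_of RA w) = class_of RB (wr s w).
Proof.
apply/class_ofP; have [_ ->] := cong_wl2 (repr (class_of RB s)) (cong_repr RA w).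
exact: (cong_wr1 _ (cong_repr RB s)).1.
Qed.

Lemma pact_matched : matched_pair pact_l pact_r.
Proof.
have pA := @class_of_repr A RA; have pB := @class_of_repr B RB.
split.
- by move=> a; rewrite -[a]pB -class_of1 pact_lE wl_nil.
- by move=> u; rewrite -[u]pA -class_of1 pact_lE.
- by move=> u; rewrite -[u]pA -class_of1 pact_rE.
- by move=> a; rewrite -[a]pB -class_of1 pact_rE wr_nil.
- move=> a b u; rewrite -[a]pB -[b]pB -[u]pA.
  by rewrite class_ofM !pact_lE wl_cat1.
- move=> a u v; rewrite -[a]pB -[u]pA -[v]pA.
  by rewrite class_ofM !pact_rE wr_cat2.
- move=> a u v; rewrite -[a]pB -[u]pA -[v]pA.
  by rewrite class_ofM pact_rE !pact_lE wl_cat2 class_ofM.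
- move=> a b u; rewrite -[a]pB -[b]pB -[u]pA.
  by rewrite class_ofM pact_lE !pact_rE wr_cat1 class_ofM.
Qed.

End PresentedActions.

Arguments pact_l {A B} rho {RA RB} b u.
Arguments pact_r {A B} rho {RA RB} b u.

(** * Presentations of double cross products *)

Section Evaluation.
Variables (A : Type) (R : word A -> word A -> Prop) (M : monoidType) (f : A -> M).

Definition word_eval (w : word A) : M := foldr (fun a m => f a * m) 1 w.

Lemma word_eval_cat u v : word_eval (u ++ v) = word_eval u * word_eval v.
Proof. by elim: u => [|a u IHu] /=; rewrite ?mul1g // IHu mulgA. Qed.

Hypothesis fR : forall u v, R u v -> word_eval u = word_eval v.

Lemma word_eval_cong u v : congruence R u v -> word_eval u = word_eval v.
Proof.
elim=> {u v} [p u v q uv|u|u v _|v u w _ + _] //; last by move=> -> ->.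
by rewrite !word_eval_cat (fR uv).
Qed.

End Evaluation.

Section DoubleCrossPresentation.
Variables (A B C : Type) (rho : B * A -> A * B).
Variables (RA : word A -> word A -> Prop) (RB : word B -> word B -> Prop).
Variables (RC : word C -> word C -> Prop) (iA : A -> C) (iB : B -> C).
Hypotheses (cl : compatl rho RA) (cr : compatr rho RB).
Hypothesis RAC : forall u v, RA u v -> congruence RC (map iA u) (map iA v).
Hypothesis RBC : forall u v, RB u v -> congruence RC (map iB u) (map iB v).
Hypothesis rhoC : forall b a, congruence RC [:: iB b; iA a]
  [:: iA (rho (b, a)).1; iB (rho (b, a)).2].

Lemma cong_push b w : congruence RC (iB b :: map iA w)
  (map iA (push rho b w).1 ++ [:: iB (push rho b w).2]).
Proof.
elim: w b => [|a w IHw] b /=; first exact: cong_refl.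
apply: cong_trans (cong_cat (rhoC b a) (cong_refl _ (map iA w))) _.
exact: (cong_cat (cong_refl _ [:: _]) (IHw _)).
Qed.

Lemma cong_pushw s w : congruence RC (map iB s ++ map iA w)
  (map iA (wl rho s w) ++ map iB (wr rho s w)).
Proof.
rewrite /wl /wr; elim: s => [|b s IHs] /=.
  by rewrite cats0; exact: cong_refl.
apply: cong_trans (cong_cat (cong_refl _ [:: iB b]) IHs) _.
rewrite -cat_rcons -cats1 catA.
by apply: cong_cat (cong_push _ _) (cong_refl _ _).
Qed.

Local Notation mp := (pact_matched cl cr).
(** This exhibits [C] as the disjoint union of [A] and [B]. An abstract [split] covers both the
    letters [X + Y] and the signed letters [(X + Y) * bool]. *)
Variable split : C -> A + B.
Hypothesis splitA : forall a, split (iA a) = inl a.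
Hypothesis splitB : forall b, split (iB b) = inr b.
Hypothesis splitK : forall c, c = match split c with inl a => iA a | inr b => iB b end.

Definition dc_gen (c : C) : double_cross mp :=
  match split c with
  | inl a => (class_of RA [:: a], 1)
  | inr b => (1, class_of RB [:: b])
  end.

Lemma dc_presE (u v : presented RA) (a b : presented RB) :
  ((u, a) : double_cross mp) * ((v, b) : double_cross mp) =
  ((u * pact_l rho a v, pact_r rho a v * b) : double_cross mp).
Proof. by []. Qed.

Lemma dc_mulll (u v : presented RA) :
  ((u, 1) : double_cross mp) * ((v, 1) : double_cross mp) = ((u * v, 1) : double_cross mp).
Proof. by rewrite dc_mulE (mp_1lact mp) (mp_1ract mp) mulg1. Qed.

Lemma dc_mulrr (a b : presented RB) :
  ((1, a) : double_cross mp) * ((1, b) : double_cross mp) = ((1, a * b) : double_cross mp).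
Proof. by rewrite dc_mulE (mp_lact1 mp) (mp_ract1 mp) mulg1. Qed.

Lemma dc_mullr (u : presented RA) (b : presented RB) :
  ((u, 1) : double_cross mp) * ((1, b) : double_cross mp) = ((u, b) : double_cross mp).
Proof. by rewrite dc_mulE (mp_lact1 mp) (mp_ract1 mp) mulg1 mul1g. Qed.

Lemma dc_mulrl (a : presented RB) (v : presented RA) :
  ((1, a) : double_cross mp) * ((v, 1) : double_cross mp) =
  ((pact_l rho a v, pact_r rho a v) : double_cross mp).
Proof. by rewrite dc_mulE mulg1 mul1g. Qed.

Lemma dc_evalA w : word_eval dc_gen (map iA w) = (class_of RA w, 1).
Proof.
elim: w => // a w /= ->.
by rewrite {1}/dc_gen splitA dc_mulll class_ofM.
Qed.

Lemma dc_evalB w : word_eval dc_gen (map iB w) = (1, class_of RB w).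
Proof.
elim: w => // a w /= ->.
by rewrite {1}/dc_gen splitB dc_mulrr class_ofM.
Qed.

Hypothesis dcR : forall u v, RC u v -> word_eval dc_gen u = word_eval dc_gen v.

(** The product map is multiplicative because the relations [RC] let letters of [B] cross letters of
    [A], by [cong_pushw]. Its inverse evaluates words at [dc_gen], which is well defined by
    [dcR]. *)
Lemma presented_double_cross :
  is_double_cross (pres_map RC iA : presented RA -> presented RC)
    (pres_map RC iB : presented RB -> presented RC) mp.
Proof.
have pA := @class_of_repr A RA; have pB := @class_of_repr B RB.
set m := fun p : double_cross mp => pres_map RC iA p.1 * pres_map RC iB p.2.
have mE u s : m (class_of RA u, class_of RB s) = class_of RC (map iA u ++ map iB s).
  by rewrite /m /= !pres_mapE // class_ofM.
have m1 : m 1 = 1 by rewrite (mE [::] [::]).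
have mM : {morph m : p q / p * q}.
  move=> [u a] [v b]; rewrite -[u]pA -[v]pA -[a]pB -[b]pB dc_presE pact_lE // pact_rE //.
  rewrite (class_ofM RA) (class_ofM RB) !mE (class_ofM RC); apply/class_ofP.
  rewrite !map_cat -!catA; apply: cong_cat (cong_refl _ _) _; rewrite !catA.
  by apply: cong_cat (cong_refl _ _); apply: cong_sym; exact: cong_pushw.
split; first by split.
exists (fun z => word_eval dc_gen (repr z)).
- move=> [u a]; rewrite -[X in repr X]/(m (u, a)) -[u]pA -[a]pB mE.
  rewrite (word_eval_cong dcR (cong_repr RC _)) word_eval_cat dc_evalA dc_evalB.
  exact: dc_mullr.
(* Since [m] is multiplicative, this composite need only be checked on letters. *)
- suff mev w : m (word_eval dc_gen w) = class_of RC w.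
    by move=> z; rewrite -[RHS](@class_of_repr C RC); exact: mev.
  elim: w => // c w IHw; rewrite [word_eval _ _]/= mM IHw.
  rewrite -[c :: w]cat1s -class_ofM; congr (_ * _).
  rewrite /dc_gen [in RHS](splitK c); case: (split c) => [a|b].
  + by rewrite (mE [:: a] [::]).
  + by rewrite (mE [::] [:: b]).
Qed.

End DoubleCrossPresentation.

(** * Mixed braid relations *)

Lemma cong_rel (A : Type) (R : word A -> word A -> Prop) u v :
  R u v -> congruence R u v.
Proof. by move=> /(cong_step [::] [::]); rewrite !cats0. Qed.

(** [m12] and [m23] generalise [r12] and [r23] to maps that change the types of the factors. *)
Definition m12 (P Q R : Type) (f : P -> Q) (p : P * R) : Q * R := (f p.1, p.2).

Definition m23 (P Q R Q' R' : Type) (f : Q * R -> Q' * R') (p : P * Q * R) :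
    P * Q' * R' :=
  let q := f (p.1.2, p.2) in (p.1.1, q.1, q.2).

Lemma m12K (P Q R : Type) (f : P -> Q) g :
  cancel f g -> cancel (m12 f) (@m12 Q P R g).
Proof. by move=> fK [p s]; rewrite /m12 /= fK. Qed.

Lemma m23K (P Q R Q' R' : Type) (f : Q * R -> Q' * R') g :
  cancel f g -> cancel (@m23 P Q R Q' R' f) (m23 g).
Proof. by move=> fK [[p s] t]; rewrite /m23 /= -surjective_pairing fK. Qed.

Section MixedBraid.
Variables (A B : Type) (rho : B * A -> A * B).
Variables (rA : A * A -> A * A) (rB : B * B -> B * B).

(** When [A = B] and all maps are [r], both [braid_l] and [braid_r] are [ybe r], so what follows
    also applies to a Yang-Baxter map itself. *)
Definition braid_l : Prop :=
  m12 rA \o m23 rho \o m12 rho =1 m23 rho \o m12 rho \o m23 rA.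

Definition braid_r : Prop :=
  m12 rho \o m23 rho \o m12 rB =1 m23 rB \o m12 rho \o m23 rho.

(** Two components of the braid relation say that the transformed words again form a defining
    relation, the third that the letter coming out is the same. *)
Lemma braid_compatl : braid_l -> compatl rho (monoid_rel rA).
Proof.
move=> brA b u v [x y z t E]; have := brA (b, x, y).
rewrite /m12 /m23 /= E /= => -[E1 E2]; rewrite /wl /wr /= E2; split=> //.
by apply: cong_rel; constructor.
Qed.

Lemma braid_compatr : braid_r -> compatr rho (monoid_rel rB).
Proof.
move=> brB a s t [x y z w E]; have := brB (x, y, a).
rewrite /m12 /m23 /= E /= [rho (z, _)]surjective_pairing => -[E1 E2 E3].
rewrite /wl /wr /= E1; split=> //.
by apply: cong_rel; constructor; rewrite E2 E3 -surjective_pairing.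
Qed.

End MixedBraid.

Section InverseBraid.
Variables (A B : Type) (rho : B * A -> A * B) (sig : A * B -> B * A).
Hypotheses (rhoK : cancel rho sig) (sigK : cancel sig rho).

(** Compose the relation on both sides with the inverse of [m23 rho \o m12 rho]. Only [rho] is
    inverted, not [rA], and the side changes because [sig] exchanges the factors. *)
Lemma braid_l_inv rA : braid_l rho rA -> braid_r sig rA.
Proof.
move=> brA p /=; rewrite -{1}(m23K sigK p) -{1}(m12K sigK (m23 sig p)).
have /= -> := brA (m12 sig (m23 sig p)).
by rewrite (m23K rhoK) (m12K rhoK).
Qed.

Lemma braid_r_inv rB : braid_r rho rB -> braid_l sig rB.
Proof.
move=> brB p /=; rewrite -[X in m23 rB X](m12K sigK).
rewrite -[X in m12 rho X](m23K sigK).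
have /= <- := brB (m23 sig (m12 sig p)).
by rewrite (m12K rhoK) (m23K rhoK).
Qed.

(** The inverse is given by the actions built from [sig], which descend to classes by the last two
    hypotheses. *)
Lemma pact_strong RA RB : compatl rho RA -> compatr rho RB ->
  compatl sig RB -> compatr sig RA ->
  strong (@pact_l _ _ rho RA RB) (@pact_r _ _ rho RA RB).
Proof.
move=> cl cr cl' cr'; have pA := @class_of_repr A RA; have pB := @class_of_repr B RB.
exists (fun p => (pact_l sig p.1 p.2, pact_r sig p.1 p.2)) => -[] /=.
- move=> a u; rewrite -[a]pB -[u]pA pact_lE // pact_rE // pact_lE // pact_rE //.
  by rewrite (wl_inv rhoK) (wr_inv rhoK).
- move=> u a; rewrite -[a]pB -[u]pA pact_lE // pact_rE // pact_lE // pact_rE //.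
  by rewrite (wl_inv sigK) (wr_inv sigK).
Qed.

End InverseBraid.

Section RestrictedBraid.
Variables (Z A B : Type) (r : Z * Z -> Z * Z) (rho : B * A -> A * B).
Variables (rA : A * A -> A * A) (rB : B * B -> B * B) (f : A -> Z) (g : B -> Z).
Hypotheses (finj : injective f) (ginj : injective g) (br : ybe r).
Hypothesis rhor : forall b a, r (g b, f a) = (f (rho (b, a)).1, g (rho (b, a)).2).

(** This is the Yang-Baxter equation at [(g b, f x, f y)]. With [f] and [g] taken among [inl], [inr]
    and the identity, it and its dual yield every relation used below. *)
Lemma ybe_braid_l :
  (forall x y, r (f x, f y) = (f (rA (x, y)).1, f (rA (x, y)).2)) -> braid_l rho rA.
Proof.
move=> rfE [[b x] y]; have := br (g b, f x, f y).
rewrite /r12 /r23 /m12 /m23 /= !(rhor, rfE) /=.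
move=> -[/finj E1 /finj E2 /ginj E3].
by rewrite [rA (_, _)]surjective_pairing E1 E2 E3.
Qed.

Lemma ybe_braid_r :
  (forall x y, r (g x, g y) = (g (rB (x, y)).1, g (rB (x, y)).2)) -> braid_r rho rB.
Proof.
move=> rgE [[b c] x]; have := br (g b, g c, f x).
rewrite /r12 /r23 /m12 /m23 /= !(rhor, rgE) /=.
move=> -[/finj E1 /ginj E2 /ginj E3].
by rewrite [rho (_, _)]surjective_pairing E1 E2 E3.
Qed.

End RestrictedBraid.

(** * Actions of an associated monoid on itself *)

Section SelfActions.
Variables (X : Type) (r : X * X -> X * X).

Lemma pact_extends (Y : Type) (rho : Y * X -> X * Y) (rY : Y * Y -> Y * Y) :
  compatl rho (monoid_rel r) -> compatr rho (monoid_rel rY) ->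
  extends_ground (mgen r) (mgen rY) (fun y x => (rho (y, x)).1)
    (fun y x => (rho (y, x)).2)
    (pact_l rho : assoc_monoid rY -> assoc_monoid r -> assoc_monoid r)
    (pact_r rho : assoc_monoid rY -> assoc_monoid r -> assoc_monoid rY).
Proof. by move=> cl cr y x; rewrite /mgen pact_lE // pact_rE. Qed.

Lemma ybe_self_actions : ybe r ->
  self_actions r (@pact_l _ _ r (monoid_rel r) (monoid_rel r))
    (@pact_r _ _ r (monoid_rel r) (monoid_rel r)).
Proof.
move=> br; have cl := braid_compatl br; have cr := braid_compatr br.
split; [exact: pact_extends|exact: pact_matched| |].
- by move=> u v; rewrite /pact_l /pact_r !degreeE size_wl size_wr.
- move=> u v; rewrite -[u in RHS](@class_of_repr X (monoid_rel r)).
  rewrite -[v in RHS](@class_of_repr X (monoid_rel r)) [LHS]class_ofM [RHS]class_ofM.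
  (* The braided identity is [cong_pushw] with the identity for both embeddings, hence the inserted
     [map id]. *)
  apply/class_ofP/cong_sym; rewrite -{1}[repr u]map_id -{1}[repr v]map_id.
  rewrite -[wl _ _ _]map_id -[wr _ _ _]map_id; apply: cong_pushw => b a.
  by apply: cong_rel; constructor; rewrite -surjective_pairing.
Qed.

End SelfActions.

(** * Gluing the mixed relations into the Yang-Baxter equation *)

Section RegularExtensionBraid.
Variables (X Y : Type) (rX : X * X -> X * X) (rY : Y * Y -> Y * Y).
Variables (lact : Y -> X -> X) (ract : Y -> X -> Y) (hreg : regular lact ract).
Local Notation r := (regular_extension rX rY hreg).
Local Notation rho := (ground_map lact ract).
Local Notation sig := (ground_inv hreg).

(* On XYX both sides are conjugates by rho of those on YXX, and on XXY they are
   obtained by inverting rho; dually with the roles of X and Y exchanged. *)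
Lemma regular_extension_ybe :
  ybe rX -> ybe rY -> braid_l rho rX -> braid_r rho rY -> ybe r.
Proof.
move=> brX brY brl brr.
have rhoK := ground_mapK hreg; have sigK := ground_invK hreg.
have sigE d w : sig (lact d w, ract d w) = (d, w) := rhoK (d, w).
have irl := braid_r_inv rhoK sigK brr; have irr := braid_l_inv rhoK sigK brl.
case=> [[[x|a] [y|b]] [z|c]]; rewrite /r12 /r23 /=.
- by have [-> ->] := brX (x, y, z).
- have := irr (x, y, c); rewrite /m12 /m23 /=.
  rewrite [sig ((rX _).1, _)]surjective_pairing => -[-> -> ->] //.
- case E: (sig (x, b)) => [d w]; have := sigK (x, b); rewrite E => -[<- <-] /=.
  by have := brl (d, w, z); rewrite /m12 /m23 /= => -[-> ->]; rewrite sigE.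
- have := irl (x, b, c); rewrite /m12 /m23 /=.
  by rewrite [rY _ in LHS]surjective_pairing => -[-> -> ->].
- have := brl (a, y, z); rewrite /m12 /m23 /=.
  by rewrite [rX _ in LHS]surjective_pairing => -[-> -> ->].
- case E: (sig (y, c)) => [d w]; have := sigK (y, c); rewrite E => -[<- <-] /=.
  have := brr (a, d, w); rewrite /m12 /m23 /= => -[<- <- <-].
  by rewrite sigE.
- have := brr (a, b, z); rewrite /m12 /m23 /=.
  by rewrite [rY _ in RHS]surjective_pairing => -[-> -> ->].
- by have [-> ->] := brY (a, b, c).
Qed.

End RegularExtensionBraid.

(** * Identities forced by the canonical actions *)

Section CanonicalConsequences.
Variables (S T U : monoidType) (iS : S -> U) (iT : T -> U).
Variables (la : T -> S -> S) (ra : T -> S -> T) (mp : matched_pair la ra).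
Hypothesis dc : is_double_cross iS iT mp.

Local Notation dot := (dot iS iT).

Lemma dot_inj u v a b : dot u a = dot v b -> u = v /\ a = b.
Proof. by move=> E; have [-> ->] := bij_inj dc.2 (E : _ (u, a) = _ (v, b)). Qed.

Hypotheses (iS1 : iS 1 = 1) (iT1 : iT 1 = 1).

Lemma dot_1r u : dot u 1 = iS u.
Proof. by rewrite /Defs.dot iT1 mulg1. Qed.

Lemma dot_1l a : dot 1 a = iT a.
Proof. by rewrite /Defs.dot iS1 mul1g. Qed.

Lemma mul_iT_iS a u : iT a * iS u = dot (la a u) (ra a u).
Proof.
have [[_ mM] _] := dc.
have := mM ((1, a) : double_cross mp) ((u, 1) : double_cross mp).
by rewrite dc_mulE mul1g mulg1 /= iS1 iT1 mul1g mulg1.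
Qed.

Section LeftFactor.
Variables (lS rS : S -> S -> S) (lSU : U -> S -> S) (rSU : U -> S -> U).
Hypotheses (mpS : matched_pair lS rS) (can : canonical_SU iS iT la ra lS rS lSU rSU).
Hypothesis mpSU : matched_pair lSU rSU.

(** The element [iT a * iS u] is also [dot (la a u) (ra a u)]. Letting both expressions act on [v]
    gives the first identity; letting [v] act on both gives the other two, by uniqueness of the
    components of a [dot]. *)
Lemma canonical_SU_compat a u v :
  [/\ la a (lS u v) = lS (la a u) (la (ra a u) v),
      la (ra a (lS u v)) (rS u v) = rS (la a u) (la (ra a u) v) &
      ra (ra a (lS u v)) (rS u v) = ra (ra a u) v].
Proof.
have lS' x y : lSU (iS x) y = lS x y by rewrite -dot_1r (can _ _ _).1 (mp_1lact mp).
have lT' b y : lSU (iT b) y = la b y by rewrite -dot_1l (can _ _ _).1 (mp_1lact mpS).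
have rS' x y : rSU (iS x) y = iS (rS x y).
  by rewrite -dot_1r (can _ _ _).2 (mp_1lact mp) (mp_1ract mp) dot_1r.
have rT' b y : rSU (iT b) y = iT (ra b y).
  by rewrite -dot_1l (can _ _ _).2 (mp_1ract mpS) dot_1l.
have := mp_lactA mpSU (iT a) (iS u) v; have := mp_ractM mpSU (iT a) (iS u) v.
rewrite lS' lT' rT' rS' !mul_iT_iS (can _ _ _).1 (can _ _ _).2.
by move=> /dot_inj[-> ->] ->.
Qed.

End LeftFactor.

Section RightFactor.
Variables (lT rT : T -> T -> T) (lUT : T -> U -> U) (rUT : T -> U -> T).
Hypotheses (mpT : matched_pair lT rT) (can : canonical_UT iS iT la ra lT rT lUT rUT).
Hypothesis mpUT : matched_pair lUT rUT.

(** Dually, the two expressions of [iT b * iS u] act on [a], which gives the last identity, and are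
    acted on by [a], which gives the first two. *)
Lemma canonical_UT_compat a b u :
  [/\ la a (la b u) = la (lT a b) (la (rT a b) u),
      lT (ra a (la b u)) (ra b u) = ra (lT a b) (la (rT a b) u) &
      rT (ra a (la b u)) (ra b u) = ra (rT a b) u].
Proof.
have lS' c x : lUT c (iS x) = iS (la c x).
  by rewrite -dot_1r (can _ _ _).1 (mp_lact1 mpT) dot_1r.
have lT' c d : lUT c (iT d) = iT (lT c d).
  by rewrite -dot_1l (can _ _ _).1 (mp_lact1 mp) (mp_ract1 mp) dot_1l.
have rS' c x : rUT c (iS x) = ra c x.
  by rewrite -dot_1r (can _ _ _).2 (mp_ract1 mpT).
have rT' c d : rUT c (iT d) = rT c d.
  by rewrite -dot_1l (can _ _ _).2 (mp_ract1 mp).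
have := mp_ractA mpUT a (iT b) (iS u); have := mp_lactM mpUT a (iT b) (iS u).
rewrite lT' !rT' lS' rS' !mul_iT_iS (can _ _ _).1 (can _ _ _).2.
by move=> /dot_inj[-> ->] ->.
Qed.

End RightFactor.
End CanonicalConsequences.

(** Defining relations join words of length two, so no word of length at most one is congruent to
    another word. *)
Lemma mgen_inj (X : Type) (r : X * X -> X * X) : injective (mgen r).
Proof.
suff cong1 u v : congruence (monoid_rel r) u v ->
    size u = size v /\ (size u <= 1 -> u = v).
  by move=> x y /class_ofP/cong1[_ /(_ isT)[]].
elim=> {u v} [p u v q [x y z t _]|u|u v _ [-> uv]|v u w _ [-> uv] _ [-> vw]] //.
- by rewrite !size_cat /=; split=> //; rewrite !addnS.
- by split=> // s1; rewrite uv.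
- by split=> // s1; rewrite uv ?vw.
Qed.

(** * Recovering the mixed relations, and restricting the extended map *)

Section MonoidPart.
Variables (X Y : Type) (rX : X * X -> X * X) (rY : Y * Y -> Y * Y).
Variables (lact : Y -> X -> X) (ract : Y -> X -> Y) (hreg : regular lact ract).
Local Notation r := (regular_extension rX rY hreg).
Local Notation rho := (ground_map lact ract).
Local Notation S := (assoc_monoid rX).
Local Notation T := (assoc_monoid rY).
Local Notation U := (assoc_monoid r).
Local Notation iS := (monoid_inl rX rY hreg).
Local Notation iT := (monoid_inr rX rY hreg).

Section Converse.
Variables (la : T -> S -> S) (ra : T -> S -> T) (mp : matched_pair la ra).
Hypothesis ext : extends_ground (mgen rX) (mgen rY) lact ract la ra.
Hypothesis dc : is_double_cross iS iT mp.

Let iS1 : iS 1 = 1 := (monoid_inl_morphism rX rY hreg).1.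
Let iT1 : iT 1 = 1 := (monoid_inr_morphism rX rY hreg).1.

Lemma canonical_braid_l lS rS lSU rSU :
  self_actions rX lS rS -> canonical_SU iS iT la ra lS rS lSU rSU ->
  matched_pair lSU rSU -> braid_l rho rX.
Proof.
move=> saX can mpSU [[a x] y].
have := canonical_SU_compat dc iS1 iT1 (sa_matched saX) can mpSU
  (mgen rY a) (mgen rX x) (mgen rX y).
have eX u v := sa_extends saX u v.
(* On generators every term is again a generator, so the identities descend to letters by
   [mgen_inj]. *)
rewrite !((ext _ _).1, (ext _ _).2, (eX _ _).1, (eX _ _).2).
move=> [H1 H2 H3].
have E1 := mgen_inj H1; have E2 := mgen_inj H2; have E3 := mgen_inj H3.
by rewrite /m12 /m23 /= E1 E2 E3 -surjective_pairing.
Qed.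

Lemma canonical_braid_r lT rT lUT rUT :
  self_actions rY lT rT -> canonical_UT iS iT la ra lT rT lUT rUT ->
  matched_pair lUT rUT -> braid_r rho rY.
Proof.
move=> saY can mpUT [[a b] x].
have := canonical_UT_compat dc iS1 iT1 (sa_matched saY) can mpUT
  (mgen rY a) (mgen rY b) (mgen rX x).
have eY u v := sa_extends saY u v.
rewrite !((ext _ _).1, (ext _ _).2, (eY _ _).1, (eY _ _).2).
move=> [H1 H2 H3].
have E1 := mgen_inj H1; have E2 := mgen_inj H2; have E3 := mgen_inj H3.
by rewrite /m12 /m23 /= E1 E2 E3.
Qed.

End Converse.

Section Direct.
Hypothesis br : ybe r.

(** The restriction of the extended map to [Z x X], and below to [Y x Z]; they induce the matched
    pairs [(S, U)] and [(U, T)]. *)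
Definition rho_XZ (p : (X + Y) * X) : X * (X + Y) :=
  match p with
  | (inl x, y) => ((rX (x, y)).1, inl (rX (x, y)).2)
  | (inr a, y) => (lact a y, inr (ract a y))
  end.

Definition rho_ZY (p : Y * (X + Y)) : (X + Y) * Y :=
  match p with
  | (a, inl x) => (inl (lact a x), ract a x)
  | (a, inr b) => (inr (rY (a, b)).1, (rY (a, b)).2)
  end.

Let inl_inj : injective (@inl X Y). Proof. by move=> x y []. Qed.
Let inr_inj : injective (@inr X Y). Proof. by move=> x y []. Qed.

Lemma ground_braid_l : braid_l rho rX.
Proof. exact: (ybe_braid_l inl_inj inr_inj br). Qed.

Lemma ground_braid_r : braid_r rho rY.
Proof. exact: (ybe_braid_r inl_inj inr_inj br). Qed.

Lemma restricted_ybe_l : ybe rX.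
Proof. exact: (ybe_braid_l inl_inj inl_inj br). Qed.

Lemma restricted_ybe_r : ybe rY.
Proof. exact: (ybe_braid_l inr_inj inr_inj br). Qed.

Lemma XZ_compat : compatl rho_XZ (monoid_rel rX) /\ compatr rho_XZ (monoid_rel r).
Proof.
have rE z x : r (z, inl x) = (inl (rho_XZ (z, x)).1, (rho_XZ (z, x)).2) by case: z.
split; [apply: braid_compatl|apply: braid_compatr].
- exact: (ybe_braid_l inl_inj (@inj_id _) br).
- by apply: (ybe_braid_r inl_inj (@inj_id _) br) => // x y; case: (r _).
Qed.

Lemma ZY_compat : compatl rho_ZY (monoid_rel r) /\ compatr rho_ZY (monoid_rel rY).
Proof.
have rE a z : r (inr a, z) = ((rho_ZY (a, z)).1, inr (rho_ZY (a, z)).2) by case: z.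
split; [apply: braid_compatl|apply: braid_compatr].
- by apply: (ybe_braid_l (@inj_id _) inr_inj br) => // x y; case: (r _).
- exact: (ybe_braid_r (@inj_id _) inr_inj br).
Qed.

End Direct.
End MonoidPart.

(** * The double cross product and the canonical actions, computed on words *)

Section DirectPart.
Variables (X Y : Type) (rX : X * X -> X * X) (rY : Y * Y -> Y * Y).
Variables (lact : Y -> X -> X) (ract : Y -> X -> Y) (hreg : regular lact ract).
Local Notation r := (regular_extension rX rY hreg).
Local Notation rho := (ground_map lact ract).
Local Notation sig := (ground_inv hreg).
Local Notation MX := (monoid_rel rX).
Local Notation MY := (monoid_rel rY).
Local Notation MZ := (monoid_rel r).

Lemma inl_rel u v : MX u v -> congruence MZ (map inl u) (map inl v).
Proof. by case=> x y z t E; apply: cong_rel; constructor; rewrite /= E. Qed.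

Lemma inr_rel u v : MY u v -> congruence MZ (map inr u) (map inr v).
Proof. by case=> x y z t E; apply: cong_rel; constructor; rewrite /= E. Qed.

Lemma ground_double_cross (cl : compatl rho MX) (cr : compatr rho MY) :
  is_double_cross (monoid_inl rX rY hreg) (monoid_inr rX rY hreg)
    (pact_matched cl cr).
Proof.
apply: (presented_double_cross inl_rel inr_rel _ (split := id)) => //.
- by move=> b a; apply: cong_rel; constructor.
- by case.
move=> _ _ [[x|a] [y|b] z t /=].
- case=> <- <- /=; rewrite !mulg1 /dc_gen !dc_mulll !class_ofM; congr (_, _).
  by apply/class_ofP/cong_rel; constructor; rewrite -surjective_pairing.
(* Here [x = lact d w] and [b = ract d w], so this relation is that of the pair [(d, w)] read
   backwards. *)
- case E: (sig (x, b)) => [d w]; have := ground_invK hreg (x, b).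
  rewrite E => -[<- <-] -[<- <-] /=; rewrite !mulg1 /dc_gen.
  by rewrite dc_mullr dc_mulrl pact_lE // pact_rE.
- case=> <- <- /=; rewrite !mulg1 /dc_gen.
  by rewrite dc_mullr dc_mulrl pact_lE // pact_rE.
- case=> <- <- /=; rewrite !mulg1 /dc_gen !dc_mulrr !class_ofM; congr (_, _).
  by apply/class_ofP/cong_rel; constructor; rewrite -surjective_pairing.
Qed.

(** Letters keep their component when they cross. Hence on words from one component the restricted
    maps act through [rX], [rY] or the ground map, as recorded here and in the next seven lemmas. *)
Lemma wl_XZ_inl s w : wl (rho_XZ rX lact ract) (map inl s) w = wl rX s w.
Proof. by rewrite -{1}[w]map_id -[RHS]map_id; apply: wl_map. Qed.

Lemma wr_XZ_inl s w : wr (rho_XZ rX lact ract) (map inl s) w = map inl (wr rX s w).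
Proof. by rewrite -{1}[w]map_id; apply: wr_map. Qed.

Lemma wl_XZ_inr s w : wl (rho_XZ rX lact ract) (map inr s) w = wl rho s w.
Proof. by rewrite -{1}[w]map_id -[RHS]map_id; apply: wl_map. Qed.

Lemma wr_XZ_inr s w : wr (rho_XZ rX lact ract) (map inr s) w = map inr (wr rho s w).
Proof. by rewrite -{1}[w]map_id; apply: wr_map. Qed.

Lemma wl_ZY_inl s w : wl (rho_ZY rY lact ract) s (map inl w) = map inl (wl rho s w).
Proof. by rewrite -{1}[s]map_id; apply: wl_map. Qed.

Lemma wr_ZY_inl s w : wr (rho_ZY rY lact ract) s (map inl w) = wr rho s w.
Proof. by rewrite -{1}[s]map_id -[RHS]map_id; apply: wr_map. Qed.

Lemma wl_ZY_inr s w : wl (rho_ZY rY lact ract) s (map inr w) = map inr (wl rY s w).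
Proof. by rewrite -{1}[s]map_id; apply: wl_map. Qed.

Lemma wr_ZY_inr s w : wr (rho_ZY rY lact ract) s (map inr w) = wr rY s w.
Proof. by rewrite -{1}[s]map_id -[RHS]map_id; apply: wr_map. Qed.

Lemma dotE s w :
  dot (monoid_inl rX rY hreg) (monoid_inr rX rY hreg) (class_of MX s) (class_of MY w) =
  class_of MZ (map inl s ++ map inr w).
Proof.
rewrite /dot /monoid_inl /monoid_inr (pres_mapE inl_rel) (pres_mapE inr_rel).
exact: class_ofM.
Qed.

Hypothesis br : ybe r.

(** A word for [u.a] is a word in [X] followed by a word in [Y], so the canonical formulas are the
    rules for the action of a concatenation. *)
Lemma pact_canonical_SU :
  canonical_SU (monoid_inl rX rY hreg) (monoid_inr rX rY hreg)
    (pact_l rho) (pact_r rho) (pact_l rX) (pact_r rX)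
    (pact_l (rho_XZ rX lact ract)) (pact_r (rho_XZ rX lact ract)).
Proof.
have brX := restricted_ybe_l br.
have [cl cr] := XZ_compat br.
have clg := braid_compatl (ground_braid_l br).
have crg := braid_compatr (ground_braid_r br).
have clX := braid_compatl brX; have crX := braid_compatr brX.
move=> u a v; rewrite -[u]class_of_repr -[a]class_of_repr -[v]class_of_repr.
rewrite dotE (pact_lE cl cr) (pact_rE cl cr) !(pact_lE clg crg).
rewrite (pact_rE clg crg) (pact_lE clX crX) (pact_rE clX crX) dotE.
by rewrite wl_cat1 wr_cat1 !wl_XZ_inr wl_XZ_inl wr_XZ_inl wr_XZ_inr.
Qed.

Lemma pact_canonical_UT :
  canonical_UT (monoid_inl rX rY hreg) (monoid_inr rX rY hreg)
    (pact_l rho) (pact_r rho) (pact_l rY) (pact_r rY)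
    (pact_l (rho_ZY rY lact ract)) (pact_r (rho_ZY rY lact ract)).
Proof.
have brY := restricted_ybe_r br.
have [cl cr] := ZY_compat br.
have clg := braid_compatl (ground_braid_l br).
have crg := braid_compatr (ground_braid_r br).
have clY := braid_compatl brY; have crY := braid_compatr brY.
move=> b u a; rewrite -[u]class_of_repr -[a]class_of_repr -[b]class_of_repr.
rewrite dotE (pact_lE cl cr) (pact_rE cl cr) !(pact_rE clg crg).
rewrite (pact_lE clg crg) (pact_lE clY crY) (pact_rE clY crY) dotE.
by rewrite wl_cat2 wr_cat2 !wr_ZY_inl wl_ZY_inl wl_ZY_inr wr_ZY_inr.
Qed.

End DirectPart.

(** * Signed letters and the associated groups *)

Section GroupPart.
Variables (X Y : Type) (rX : X * X -> X * X) (rY : Y * Y -> Y * Y).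
Variables (lact : Y -> X -> X) (ract : Y -> X -> Y) (hreg : regular lact ract).
Variables (linv : Y -> X -> X) (rinv : X -> Y -> Y).
Hypotheses (linvK : forall a, cancel (linv a) (lact a)).
Hypotheses (lactK : forall a, cancel (lact a) (linv a)).
Hypotheses (rinvK : forall x a, ract (rinv x a) x = a).
Hypotheses (ractK : forall x a, rinv x (ract a x) = a).

Local Notation r := (regular_extension rX rY hreg).
Local Notation rho := (ground_map lact ract).
Local Notation sig := (ground_inv hreg).
Local Notation GX := (group_rel rX).
Local Notation GY := (group_rel rY).
Local Notation GZ := (group_rel r).

(* The four cases read the relation a x = (lact a x) (ract a x) of the group
   from each of the four corners of the corresponding square. *)
Definition rho_signed (p : (Y * bool) * (X * bool)) : (X * bool) * (Y * bool) :=
  match p with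
  | ((a, true), (x, true)) => ((lact a x, true), (ract a x, true))
  | ((a, true), (x, false)) => ((lact (rinv x a) x, false), (rinv x a, true))
  | ((a, false), (x, true)) => ((linv a x, true), (ract a (linv a x), false))
  | ((a, false), (x, false)) => (((sig (x, a)).2, false), ((sig (x, a)).1, false))
  end.

Let sigE a x : sig (lact a x, ract a x) = (a, x).
Proof. exact: (ground_mapK hreg (a, x)). Qed.

(** If [l m = m' l'] is a square, then [l^-1 m' = m l'^-1] is the same square read from another
    corner. The next lemma likewise reads it as [l' m^-1 = m'^-1 l]. These handle the cancellation
    relations. *)
Lemma rho_signed_flipl l m :
  rho_signed (inv_letter l, (rho_signed (l, m)).1) =
  (m, inv_letter (rho_signed (l, m)).2).
Proof.
case: l m => a [] [x []] /=.
- by rewrite lactK.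
- by have := sigE (rinv x a) x; rewrite rinvK => ->.
- by rewrite linvK.
- case E: (sig (x, a)) => [d w]; have := ground_invK hreg (x, a).
  by rewrite E => -[<- <-] /=; rewrite ractK.
Qed.

Lemma rho_signed_flipr l m :
  rho_signed ((rho_signed (l, m)).2, inv_letter m) =
  (inv_letter (rho_signed (l, m)).1, l).
Proof.
case: l m => a [] [x []] /=.
- by rewrite ractK.
- by rewrite rinvK.
- by have := sigE a (linv a x); rewrite linvK => ->.
- case E: (sig (x, a)) => [d w]; have := ground_invK hreg (x, a).
  by rewrite E => -[<- <-] /=; rewrite lactK.
Qed.

Lemma rho_signed_compatl : braid_l rho rX -> compatl rho_signed GX.
Proof.
move=> brl l u v [x b|x y z t E].
- rewrite wl_nil wr_nil wl12 wr12 (rho_signed_flipr l (x, b)); split=> //.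
  by apply: cong_rel; case: (rho_signed _).1 => x' b'; exact: GroupCancel.
- case: l => a []; rewrite /wl /wr /=.
  + have := brl (a, x, y); rewrite /m12 /m23 /= E /= => -[E1 E2].
    by rewrite E2; split=> //; apply: cong_rel; apply: GroupRel.
  (* The last two entries are the letters into which [a^-1] turns [x] and [y]. Moving [a] past them
     restores [x] and [y], so the braid relation there transports the relation backwards. *)
  + have := brl (a, linv a x, linv (ract a (linv a x)) y).
    rewrite /m12 /m23 /= !linvK E => -[-> -> ->]; rewrite !lactK; split=> //.
    by apply: cong_rel; apply: GroupRel; rewrite -surjective_pairing.
Qed.

Lemma rho_signed_compatr : braid_r rho rY -> compatr rho_signed GY.
Proof.
move=> brr m s t [a b|a b c d E].
(* The second letter of the cancelling pair meets [m] first. *)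
- have := rho_signed_flipl (a, ~~ b) m.
  have -> : inv_letter (a, ~~ b) = (a, b) by rewrite /inv_letter /= negbK.
  rewrite wl21 wr21 => ->; split=> //.
  apply: cong_rel; case: (rho_signed _).2 => a' b'.
  by rewrite /= -{2}[b']negbK; exact: GroupCancel.
- case: m => x []; rewrite /wl /wr /=.
  + have := brr (a, b, x); rewrite /m12 /m23 /= E /= => -[E1 E2 E3].
    rewrite E1; split=> //; apply: cong_rel; apply: GroupRel.
    by rewrite E2 E3 -surjective_pairing.
  (* The first two entries are the letters into which [x^-1] turns [a] and [b]. *)
  + have := brr (rinv (lact (rinv x b) x) a, rinv x b, x).
    rewrite /m12 /m23 /= !rinvK E => -[<- <- <-]; rewrite !ractK; split=> //.
    by apply: cong_rel; apply: GroupRel; rewrite -surjective_pairing.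
Qed.

Definition inl_signed (l : X * bool) : (X + Y) * bool := (inl l.1, l.2).
Definition inr_signed (l : Y * bool) : (X + Y) * bool := (inr l.1, l.2).

Definition split_signed (l : (X + Y) * bool) : (X * bool) + (Y * bool) :=
  match l.1 with inl x => inl (x, l.2) | inr y => inr (y, l.2) end.

Lemma class_inv_letter (z : X + Y) :
  (class_of GZ [:: (z, false)] : assoc_group r) = (ggen r z)^-1.
Proof.
apply/esym/mulg1_eq; rewrite [LHS]class_ofM; apply/class_ofP.
exact: cong_rel (GroupCancel r z true).
Qed.

Lemma rho_signed_cong l m : congruence GZ [:: inr_signed l; inl_signed m]
  [:: inl_signed (rho_signed (l, m)).1; inr_signed (rho_signed (l, m)).2].
Proof.
pose cl z : assoc_group r := class_of GZ [:: z].
suff: cl (inr_signed l) * cl (inl_signed m) =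
    cl (inl_signed (rho_signed (l, m)).1) * cl (inr_signed (rho_signed (l, m)).2).
  by rewrite [LHS]class_ofM [RHS]class_ofM => /class_ofP.
(* The square of positive letters; the other three sign patterns follow from it by multiplying by
   inverses. *)
have key a x : ggen r (inr a) * ggen r (inl x) =
    ggen r (inl (lact a x)) * ggen r (inr (ract a x)).
  rewrite [LHS]class_ofM [RHS]class_ofM; apply/class_ofP.
  by apply: cong_rel; apply: GroupRel.
rewrite /cl; case: l m => a [] [x []]; rewrite /inr_signed /inl_signed /=
  -?/(ggen _ _) ?class_inv_letter.
- exact: key.
- apply: (canRL (mulKg _)); rewrite mulgA; apply: (canLR (mulgK _)).
  by rewrite key rinvK.
- apply: (canLR (mulKg _)); rewrite mulgA; apply: (canRL (mulgK _)).
  by rewrite key linvK.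
- case E: (sig (x, a)) => [d w]; have := ground_invK hreg (x, a).
  by rewrite E => -[<- <-] /=; rewrite -!invgM key.
Qed.

Section DoubleCrossGroup.
Hypotheses (cl : compatl rho_signed GX) (cr : compatr rho_signed GY).

Lemma signed_double_cross :
  is_double_cross (group_inl rX rY hreg) (group_inr rX rY hreg) (pact_matched cl cr).
Proof.
have RXZ u v : GX u v -> congruence GZ (map inl_signed u) (map inl_signed v).
  case=> [x b|x y z t E]; apply: cong_rel; first exact: GroupCancel.
  by apply: GroupRel; rewrite /= E.
have RYZ u v : GY u v -> congruence GZ (map inr_signed u) (map inr_signed v).
  case=> [x b|x y z t E]; apply: cong_rel; first exact: GroupCancel.
  by apply: GroupRel; rewrite /= E.
apply: (presented_double_cross RXZ RYZ _ (split := split_signed)) => //.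
- exact: rho_signed_cong.
- by case.
- by case.
- by case=> -[].
move=> _ _ [[x|a] b|[x|a] [y|b] z t] /=.
- rewrite mulg1 /dc_gen /= !dc_mulll !class_ofM; congr (_, _).
  by apply/class_ofP/cong_rel; exact: GroupCancel.
- rewrite mulg1 /dc_gen /= !dc_mulrr !class_ofM; congr (_, _).
  by apply/class_ofP/cong_rel; exact: GroupCancel.
- case=> <- <- /=; rewrite !mulg1 /dc_gen !dc_mulll !class_ofM; congr (_, _).
  by apply/class_ofP/cong_rel; apply: GroupRel; rewrite -surjective_pairing.
- case E: (sig (x, b)) => [d w]; have := ground_invK hreg (x, b).
  rewrite E => -[<- <-] -[<- <-] /=; rewrite !mulg1 /dc_gen /=.
  by rewrite dc_mullr dc_mulrl pact_lE // pact_rE.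
- case=> <- <- /=; rewrite !mulg1 /dc_gen /=.
  by rewrite dc_mullr dc_mulrl pact_lE // pact_rE.
- case=> <- <- /=; rewrite !mulg1 /dc_gen !dc_mulrr !class_ofM; congr (_, _).
  by apply/class_ofP/cong_rel; apply: GroupRel; rewrite -surjective_pairing.
Qed.

End DoubleCrossGroup.
End GroupPart.

Theorem theorem4p28 (X Y : Type) (rX : X * X -> X * X) (rY : Y * Y -> Y * Y)
    (hX : solution rX) (hY : solution rY)
    (lact : Y -> X -> X) (ract : Y -> X -> Y) (hreg : regular lact ract) :
  let r := regular_extension rX rY hreg in
  let S := assoc_monoid rX in
  let T := assoc_monoid rY in
  let U := assoc_monoid r in
  let iS := monoid_inl rX rY hreg in
  let iT := monoid_inr rX rY hreg in
  (ybe r <->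
   exists (la : T -> S -> S) (ra : T -> S -> T) (mp : matched_pair la ra),
     (* (1) *)
     [/\ strong la ra,
         extends_ground (mgen rX) (mgen rY) lact ract la ra &
         is_double_cross iS iT mp] /\
     (* (2) *)
     exists (lS rS : S -> S -> S) (lT rT : T -> T -> T)
            (lSU : U -> S -> S) (rSU : U -> S -> U)
            (lUT : T -> U -> U) (rUT : T -> U -> T),
       [/\ self_actions rX lS rS /\ self_actions rY lT rT,
           canonical_SU iS iT la ra lS rS lSU rSU,
           canonical_UT iS iT la ra lT rT lUT rUT,
           matched_pair lSU rSU &
           matched_pair lUT rUT])
  /\
  (ybe r -> nondegenerate_ground lact ract ->
   exists (lG : assoc_group rY -> assoc_group rX -> assoc_group rX)
          (rG : assoc_group rY -> assoc_group rX -> assoc_group rY)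
          (mp : matched_pair lG rG),
     extends_ground (ggen rX) (ggen rY) lact ract lG rG /\
     is_double_cross (group_inl rX rY hreg) (group_inr rX rY hreg) mp).
Proof.
move=> r S T U iS iT; split; first split.
- move=> br; have brl := ground_braid_l br; have brr := ground_braid_r br.
  have rhoK := ground_mapK hreg; have sigK := ground_invK hreg.
  have cl := braid_compatl brl; have cr := braid_compatr brr.
  (* The inverse ground map must descend as well, for strongness. *)
  have cl' := braid_compatl (braid_r_inv rhoK sigK brr).
  have cr' := braid_compatr (braid_l_inv rhoK sigK brl).
  have [clXZ crXZ] := XZ_compat br; have [clZY crZY] := ZY_compat br.
  exists (pact_l (ground_map lact ract)), (pact_r (ground_map lact ract)).
  exists (pact_matched cl cr); split.
    split; [exact: (pact_strong rhoK sigK)|exact: pact_extends|].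
    exact: ground_double_cross.
  exists (pact_l rX), (pact_r rX), (pact_l rY), (pact_r rY).
  exists (pact_l (rho_XZ rX lact ract)), (pact_r (rho_XZ rX lact ract)).
  exists (pact_l (rho_ZY rY lact ract)), (pact_r (rho_ZY rY lact ract)).
  split; [|exact: pact_canonical_SU|exact: pact_canonical_UT| |].
  + by split; apply: ybe_self_actions; [exact: sol_ybe hX|exact: sol_ybe hY].
  + exact: pact_matched clXZ crXZ.
  + exact: pact_matched clZY crZY.
- case=> la [ra [mp [[_ ext dc] [lS [rS [lT [rT [lSU [rSU [lUT [rUT]]]]]]]]]]].
  case=> -[saX saY] canS canT mpS mpT.
  apply: regular_extension_ybe (sol_ybe hX) (sol_ybe hY) _ _.
  + exact: (canonical_braid_l ext dc saX canS mpS).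
  + exact: (canonical_braid_r ext dc saY canT mpT).
- move=> br [lbij rbij].
  (* The inverses define the crossings of letters of opposite signs. *)
  have /choice[linv linvP] a : exists g, cancel (lact a) g /\ cancel g (lact a).
    by have [g gK Kg] := lbij a; exists g.
  have /choice[rinv rinvP] x : exists g, cancel (ract^~ x) g /\ cancel g (ract^~ x).
    by have [g gK Kg] := rbij x; exists g.
  have linvK a := (linvP a).2; have lactK a := (linvP a).1.
  have rinvK x := (rinvP x).2; have ractK x := (rinvP x).1.
  have cl := rho_signed_compatl hreg linvK lactK rinvK ractK (ground_braid_l br).
  have cr := rho_signed_compatr hreg linvK lactK rinvK ractK (ground_braid_r br).
  exists (pact_l (rho_signed hreg linv rinv)), (pact_r (rho_signed hreg linv rinv)).
  exists (pact_matched cl cr); split; last exact: signed_double_cross.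
  (* Generators are positive letters, on which [rho_signed] is the ground map. *)
  by move=> a x; rewrite /ggen pact_lE // pact_rE.
Qed.
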